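(* The canonical Möbius structure $M_0$ on $X=S^1$ satisfies the Increment Axiom (I): for all pairwise distinct points $o,\omega,v,\omega',o',u,x\in X$ lying on the circle in this cyclic order (in one of the two directions) such that $|ou|\,|vo'|=|ov|\,|o'u|$ and $|\omega u|\,|v\omega'|=|\omega v|\,|\omega'u|$, one has $$\frac{|ou|\,|\omega x|}{|ox|\,|\omega u|}>\frac{|\omega'u|\,|o'x|}{|\omega'x|\,|o'u|},$$ where $|\cdot\,\cdot|$ is any semi-metric from $M_0$.
   Context: A semi-metric on $X$ is a symmetric function $d:X^2\to\mathbb R\cup\{\infty\}$, positive off the diagonal, zero on it, with at most one infinitely remote point $\omega_0$, i.e. a point with $d(x,\omega_0)=\infty$ for some (then, by requirement, for all) $x\ne\omega_0$. Two semi-metrics are Möbius equivalent if they have the same cross-ratios $\frac{d(x_1,x_3)d(x_2,x_4)}{d(x_1,x_4)d(x_2,x_3)}$ on all 4-tuples of pairwise distinct points (here and in the homogeneous (in)equalities of the claim, infinite distances cancel). A Möbius structure is a Möbius equivalence class of semi-metrics. The canonical Möbius structure $M_0$ on $S^1=\mathbb R\cup\{\infty\}$ is the class of the standard metric of $\mathbb R$ extended by $|x\infty|=\infty$ for $x\in\mathbb R$; for each $u\in S^1$ its representatives with infinitely remote point $u$ are standard metrics (up to a positive factor) on $S^1\setminus\{u\}\cong\mathbb R$. *)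

(* Defs.v *)
From HB Require Import structures.
From mathcomp Require Import all_boot all_order all_algebra.
From mathcomp Require Import all_classical all_reals.

Set Implicit Arguments.
Unset Strict Implicit.
Unset Printing Implicit Defensive.

Import Order.TTheory GRing.Theory Num.Theory.

Local Open Scope classical_set_scope.
Local Open Scope ring_scope.

(* [w] is infinitely remote for [d] and is the only such point: the infinite
   distances are exactly those between [w] and the other points.  (As [d] is
   symmetric, [d x w = +oo] for some [x <> w] alone would not tell [w] from [x].) *)
Definition only_infinitely_remote (R : realType) (X : eqType)
    (d : X -> X -> \bar R) (w : X) : Prop :=
  forall x y, d x y = +oo%E <-> x != y /\ (x = w \/ y = w).

Record semimetric (R : realType) (X : eqType) := Semimetric {
  dist :> X -> X -> \bar R ;
  dist_sym : forall x y, dist x y = dist y x ;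
  dist_diag : forall x, dist x x = 0%E ;
  dist_pos : forall x y, x != y -> (0 < dist x y)%E ;
  dist_remote : (forall x y, dist x y <> +oo%E) \/
                exists w, only_infinitely_remote dist w }.

(* Infinite distances are replaced by the factor 1.  In a homogeneous quotient
   or (in)equality every point occurs equally often on both sides, so the
   infinite factors come in equal numbers and this amounts to cancelling
   them. *)
Definition cdist (R : realType) (X : eqType) (d : semimetric R X) (x y : X) : R :=
  if d x y is r%:E then r else 1.

Definition cross_ratio (R : realType) (X : eqType) (d : semimetric R X)
    (x1 x2 x3 x4 : X) : R :=
  (cdist d x1 x3 * cdist d x2 x4) / (cdist d x1 x4 * cdist d x2 x3).

Definition moebius_equiv (R : realType) (X : eqType) (d d' : semimetric R X) : Prop :=
  forall x1 x2 x3 x4 : X, uniq [:: x1; x2; x3; x4] ->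
    cross_ratio d x1 x2 x3 x4 = cross_ratio d' x1 x2 x3 x4.

Definition moebius_class (R : realType) (X : eqType) (d : semimetric R X) :
  set (semimetric R X) := [set d' | moebius_equiv d d'].

(* The circle as the real line with the point [None] at infinity. *)
Definition circle (R : realType) : eqType := option R.

Definition std_dist (R : realType) (x y : circle R) : \bar R :=
  match x, y with
  | Some a, Some b => `|a - b|%:E
  | None, None => 0%E
  | _, _ => +oo%E
  end.

Lemma std_dist_sym (R : realType) (x y : circle R) : std_dist x y = std_dist y x.
Proof. by case: x y => [a|] [b|] //=; rewrite distrC. Qed.

Lemma std_dist_diag (R : realType) (x : circle R) : std_dist x x = 0%E.
Proof. by case: x => [a|] //=; rewrite subrr normr0. Qed.

Lemma std_dist_pos (R : realType) (x y : circle R) :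
  x != y -> (0 < std_dist x y)%E.
Proof.
case: x y => [a|] [b|] ab /=; rewrite ?lt0y //.
by rewrite lte_fin normr_gt0 subr_eq0; apply: contra_neq ab => ->.
Qed.

Lemma std_dist_remote (R : realType) :
  (forall x y : circle R, std_dist x y <> +oo%E) \/
  exists w, only_infinitely_remote (@std_dist R) w.
Proof.
right; exists None => -[a|] [b|] /=; split => //.
- by case=> _ [].
- by move=> _; split => //; right.
- by move=> _; split => //; left.
- by case=> /eqP.
Qed.

Definition std_semimetric (R : realType) : semimetric R (circle R) :=
  Semimetric (@std_dist_sym R) (@std_dist_diag R) (@std_dist_pos R)
    (std_dist_remote R).

Definition canonical_moebius (R : realType) : set (semimetric R (circle R)) :=
  moebius_class (std_semimetric R).
Arguments canonical_moebius R : clear implicits.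

(* Linear order on the circle cut open at infinity, [None] being the largest
   point. *)
Definition circle_lt (R : realType) (x y : circle R) : bool :=
  match x, y with
  | Some a, Some b => a < b
  | Some _, None => true
  | None, _ => false
  end.

(* The points of [s] are met in this order when going once around the circle in
   the positive direction; they are then pairwise distinct. *)
Definition cyclically_ordered (R : realType) (s : seq (circle R)) : Prop :=
  exists n, sorted (@circle_lt R) (rot n s).

Definition increment_axiom (R : realType) (M : set (semimetric R (circle R))) : Prop :=
  forall d : semimetric R (circle R), M d ->
  forall o w v w' o' u x : circle R,
    uniq [:: o; w; v; w'; o'; u; x] ->
    cyclically_ordered [:: o; w; v; w'; o'; u; x] \/
      cyclically_ordered (rev [:: o; w; v; w'; o'; u; x]) ->
    cdist d o u * cdist d v o' = cdist d o v * cdist d o' u ->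
    cdist d w u * cdist d v w' = cdist d w v * cdist d w' u ->
    (cdist d o u * cdist d w x) / (cdist d o x * cdist d w u) >
    (cdist d w' u * cdist d o' x) / (cdist d w' x * cdist d o' u).

(* Main.v *)
(** A projective lift of the circle to the plane turns the standard distance
    into the absolute value of a determinant [D], and the lifts can be signed so
    that [D] is positive on all pairs taken in the given cyclic order.  All
    cross-ratios are then quotients of the [D]'s, which satisfy the
    Grassmann-Pluecker (Ptolemy) relation.  With [u] sent to infinity and [v] to
    0, the hypotheses say [o = -a], [o' = a], [w = -b], [w' = b] with
    [0 < b < a], and the claim at [x = -c] with [c > a] is
    [c^2 - b^2 > c^2 - a^2]. *)
Require Import Defs.
From mathcomp Require Import all_boot all_order all_algebra.
From mathcomp Require Import all_classical all_reals.
From mathcomp Require Import ring lra.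

Set Implicit Arguments.
Unset Strict Implicit.
Unset Printing Implicit Defensive.

Import Order.TTheory GRing.Theory Num.Theory.

Local Open Scope ring_scope.

Definition pluecker (R : realType) (T : Type) (D : T -> T -> R) : Prop :=
  forall p q r s, D p r * D q s = D p q * D r s + D p s * D q r.

Lemma pluecker_increment (R : realType) (T : Type) (D : T -> T -> R)
    (o w v w' o' u x : T) :
  pluecker D -> pairwise (fun p q => 0 < D p q) [:: o; w; v; w'; o'; u; x] ->
  D o u * D v o' = D o v * D o' u -> D w u * D v w' = D w v * D w' u ->
  D o x * D w u * (D w' u * D o' x) < D o u * D w x * (D w' x * D o' u).
Proof.
move=> pl; rewrite /= !andbT.
case/and5P=> /and5P[ow ov ow' oo' /andP[ou ox]] /and5P[wv _ _ wu wx].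
move=> /and4P[vw' vo' vu _] /and3P[w'o' w'u w'x] /andP[/andP[o'u o'x] ux] eo ew.
(* [|ow| = |w'o'|] in the coordinate with [u] at infinity *)
have ow_w'o' : D o w * (D w' u * D o' u) = D o u * D w u * D w' o'.
  apply: (mulfI (lt0r_neq0 vu)) => /=.
  (* With [u] at infinity, this says |ow| = |ov| - |wv|, and the next line |w'o'| = |vo'| - |vw'|;
     [eo] and [ew] match the two differences term by term. *)
  have ow_vu : D v u * D o w = D o v * D w u - D o u * D w v.
    by have := pl o w v u; lra.
  have w'o'_vu : D v u * D w' o' = D v o' * D w' u - D v w' * D o' u.
    by have := pl v w' o' u; lra.
  rewrite [LHS]mulrA ow_vu [RHS]mulrCA w'o'_vu mulrBl mulrBr.
  congr (_ - _).
    transitivity (D o v * D o' u * (D w u * D w' u)); first by ring.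
    by rewrite -eo; ring.
  transitivity (D w v * D w' u * (D o u * D o' u)); first by ring.
  by rewrite -ew; ring.
have ox_w'u : D o x * D w' u < D o u * D w' x.
  by rewrite (pl o w' u x) ltrDr mulr_gt0.
(* Multiplied by [D w' u], and with [ow_w'o'] put in, this becomes a positive multiple of
   [ox_w'u]. *)
have key : D o x * D w u * D w' o' < D o w * (D w' x * D o' u).
  rewrite -(ltr_pM2l w'u).
  have -> : D w' u * (D o x * D w u * D w' o') =
            D w u * D w' o' * (D o x * D w' u) by ring.
  have -> : D w' u * (D o w * (D w' x * D o' u)) =
            D w' x * (D o w * (D w' u * D o' u)) by ring.
  have -> : D w' x * (D o w * (D w' u * D o' u)) =
            D w u * D w' o' * (D o u * D w' x) by rewrite ow_w'o'; ring.
  by rewrite ltr_pM2l ?mulr_gt0.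
(* After both expansions the summand [D o x * D w u * (D w' x * D o' u)] cancels; what remains is
   [key] times [D u x]. *)
rewrite (pl o w u x) (pl w' o' u x) mulrDr mulrDl ltrD2r.
by rewrite [ltLHS]mulrA [ltRHS]mulrAC ltr_pM2r.
Qed.

(* Moving a point from one end of a linear order to the other amounts to
   changing the sign of its lift. *)
Lemma rot_signs (R : realType) (T : eqType) (D : T -> T -> R) n (s : seq T) :
  (forall p q, D q p = - D p q) -> uniq s ->
  pairwise (fun p q => 0 < D p q) (rot n s) ->
  exists2 e : T -> R, forall p, `|e p| = 1 &
    pairwise (fun p q => 0 < e p * e q * D p q) s.
Proof.
move=> antiD; rewrite /rot -{1 4}(cat_take_drop n s).
move: (take n s) (drop n s) => a b.
rewrite cat_uniq => /and3P[_ /hasPn ab _].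
rewrite pairwise_cat => /and3P[/allrelP ba pb pa].
(* The rotated list is [b ++ a]: only the pairs between [a] and [b] change order, and only they
   change sign. *)
exists (fun p => if p \in a then -1 else 1).
  by move=> p; case: ifP; rewrite ?normrN normr1.
rewrite pairwise_cat; apply/and3P; split.
- apply/allrelP => p q pin qin; rewrite pin (negPf (ab q qin)) mulr1 mulN1r.
  by rewrite -antiD ba.
- apply: (sub_in_pairwise (P := mem a)) pa; last exact/allP.
  by move=> p q /= -> ->; rewrite mulrNN !mul1r.
- apply: (sub_in_pairwise (P := mem b)) pb; last exact/allP.
  by move=> p q /ab/negPf-> /ab/negPf->; rewrite !mul1r.
Qed.

(* Determinant of the lifts of [y] and [x], in this order, where [Some a] is
   lifted to [(a, 1)] and [None] to [(1, 0)]. *)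
Definition circle_det (R : realType) (x y : circle R) : R :=
  match x, y with
  | Some a, Some b => b - a
  | Some _, None => 1
  | None, Some _ => -1
  | None, None => 0
  end.

Lemma circle_detC (R : realType) (x y : circle R) :
  circle_det y x = - circle_det x y.
Proof. by case: x y => [a|] [b|] /=; rewrite ?opprB ?opprK ?oppr0. Qed.

Lemma cdist_std (R : realType) (x y : circle R) :
  cdist (std_semimetric R) x y = `|circle_det x y|.
Proof.
by case: x y => [a|] [b|]; rewrite /cdist //= ?normrN ?normr1 ?normr0 // distrC.
Qed.

Lemma circle_det_pluecker (R : realType) : pluecker (@circle_det R).
Proof. by move=> [p|] [q|] [r|] [s|] /=; ring. Qed.

Lemma circle_lt_det (R : realType) (x y : circle R) :
  circle_lt x y -> 0 < circle_det x y.
Proof. by case: x y => [a|] [b|] //=; rewrite subr_gt0. Qed.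

Lemma circle_lt_trans (R : realType) : transitive (@circle_lt R).
Proof. by move=> [a|] [b|] [c|] //=; exact: lt_trans. Qed.

Lemma pluecker_scale (R : realType) (T : Type) (D : T -> T -> R) (e : T -> R) :
  pluecker D -> pluecker (fun p q => e p * e q * D p q).
Proof.
move=> pl p q r s.
transitivity (e p * e q * e r * e s * (D p r * D q s)); first by ring.
by rewrite pl; ring.
Qed.

(** This removes the absolute values: between points of [s], standard distances become values of [D]
    and obey the relation themselves. *)
Lemma cyclic_pluecker (R : realType) (s : seq (circle R)) :
  uniq s -> cyclically_ordered s \/ cyclically_ordered (rev s) ->
  exists D : circle R -> circle R -> R,
    [/\ pluecker D, forall x y, cdist (std_semimetric R) x y = `|D x y| &
        pairwise (fun p q => 0 < D p q) s].
Proof.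
move=> us ord.
have [D [plD antiD absD [n pos]]] : exists D : circle R -> circle R -> R,
    [/\ pluecker D, forall x y, D y x = - D x y,
        forall x y, cdist (std_semimetric R) x y = `|D x y| &
        exists n, pairwise (fun p q => 0 < D p q) (rot n s)].
  case: ord => -[n].
    rewrite sorted_pairwise; last exact: circle_lt_trans.
    move=> lts; exists (@circle_det R); split.
    - exact: circle_det_pluecker.
    - exact: circle_detC.
    - exact: cdist_std.
    - by exists n; apply: sub_pairwise lts; exact: circle_lt_det.
  (* Negative direction: a rotation of [s] is decreasing, so the determinant is taken with its
     arguments swapped. The relation survives, being invariant under reversal of the quadruple. *)
  rewrite -rev_rotr rev_sorted sorted_pairwise; last first.
    by move=> y x z xy yz; exact: circle_lt_trans yz xy.
  move=> lts; exists (fun x y => circle_det y x); split.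
  - move=> p q r t; rewrite mulrC (circle_det_pluecker t r q p).
    by rewrite [X in X + _]mulrC.
  - by move=> x y; exact: circle_detC.
  - by move=> x y; rewrite cdist_std circle_detC normrN.
  - exists (size s - n)%N; apply: sub_pairwise lts => x y; exact: circle_lt_det.
have [e abse epos] := rot_signs antiD us pos.
exists (fun p q => e p * e q * D p q); split => //.
  exact: pluecker_scale.
by move=> x y; rewrite !normrM !abse !mul1r absD.
Qed.

Lemma cdistC (R : realType) (X : eqType) (d : semimetric R X) x y :
  cdist d x y = cdist d y x.
Proof. by rewrite /cdist dist_sym. Qed.

Lemma cdist_gt0 (R : realType) (X : eqType) (d : semimetric R X) x y :
  x != y -> 0 < cdist d x y.
Proof. by move/(dist_pos d); rewrite /cdist; case: (d x y). Qed.

(** This makes the two equations assumed in the axiom Möbius invariant. *)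
Lemma cross_ratio_eq1 (R : realType) (X : eqType) (d : semimetric R X)
    (x1 x2 x3 x4 : X) : uniq [:: x1; x2; x3; x4] ->
  cross_ratio d x1 x2 x3 x4 = 1 <->
  cdist d x1 x3 * cdist d x2 x4 = cdist d x1 x4 * cdist d x2 x3.
Proof.
rewrite /= !inE !negb_or => /and4P[/and3P[_ _ n14] /andP[n23 _] _ _].
have nz : cdist d x1 x4 * cdist d x2 x3 != 0.
  by rewrite lt0r_neq0// mulr_gt0 ?cdist_gt0.
rewrite /cross_ratio; split=> [e1|->]; last exact: divff.
by rewrite -[LHS](divfK nz) e1 mul1r.
Qed.

Theorem proposition7p10 (R : realType) : increment_axiom (canonical_moebius R).
Proof.
move=> d Md o w v w' o' u x us ord eo ew.
have [D [plD absD pos]] := cyclic_pluecker us ord.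
have incr := pluecker_increment plD pos.
move: us; rewrite /= !inE !negb_or !andbT.
case/and5P=> /and5P[? ? ? ? /andP[? ?]] /and5P[? ? ? ? ?] /and4P[? ? ? ?].
move=> /and3P[? ? ?] /andP[/andP[? ?] ?].
have u_oo' : uniq [:: o; o'; u; v].
  by rewrite /= !inE !negb_or andbT; do ?[apply/andP; split]; rewrite // eq_sym.
have u_ww' : uniq [:: w; w'; u; v].
  by rewrite /= !inE !negb_or andbT; do ?[apply/andP; split]; rewrite // eq_sym.
have u_ow : uniq [:: o; w; u; x].
  by rewrite /= !inE !negb_or andbT; do ?[apply/andP; split].
have u_w'o' : uniq [:: w'; o'; u; x].
  by rewrite /= !inE !negb_or andbT; do ?[apply/andP; split].
have std_D p q : 0 < D p q -> cdist (std_semimetric R) p q = D p q.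
  by move=> pq; rewrite absD gtr0_norm.
move: pos; rewrite /= !andbT.
case/and5P=> /and5P[? ? ? ? /andP[? ?]] /and5P[? ? ? ? ?] /and4P[? ? ? ?].
move=> /and3P[? ? ?] /andP[/andP[? ?] ?].
have {}eo : D o u * D v o' = D o v * D o' u.
  move: eo; rewrite (cdistC d v o') => /(cross_ratio_eq1 d u_oo').
  rewrite -Md // => /(cross_ratio_eq1 _ u_oo').
  by rewrite (cdistC _ o' v) !std_D.
have {}ew : D w u * D v w' = D w v * D w' u.
  move: ew; rewrite (cdistC d v w') => /(cross_ratio_eq1 d u_ww').
  rewrite -Md // => /(cross_ratio_eq1 _ u_ww').
  by rewrite (cdistC _ w' v) !std_D.
(* Both sides of the claim are cross-ratios, so [d] can be replaced by the standard semi-metric. *)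
change (cross_ratio d w' o' u x < cross_ratio d o w u x).
rewrite -!Md // /cross_ratio !std_D // ltr_pdivrMr ?mulr_gt0 //.
rewrite mulrAC ltr_pdivlMr ?mulr_gt0 // mulrC.
exact: incr.
Qed.
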